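(* Let $G$ be a countable discrete amenable group, let $(\mathfrak{M}, \rho, G, \Xi)$ be a W*-dynamical system with $\mathcal{L}^2(\mathfrak{M}, \rho)$ separable, and let $(\mathfrak{A}, G, \Theta; \iota)$ be a faithful C*-model of $(\mathfrak{M}, \rho, G, \Xi)$ with $\mathfrak{A}$ separable and unital. Consider the following conditions. (i) The C*-dynamical system $(\mathfrak{A}, G, \Theta)$ is uniquely ergodic. (ii) The C*-dynamical system $(\mathfrak{A}, G, \Theta)$ is strictly ergodic. (iii) $\Gamma(a) = \rho(\iota(a))$ for all positive $a \in \mathfrak{A}$. Then (i)$\iff$(ii) and (i)$\Rightarrow$(iii). Further, if $\mathcal{S}^G$ is a simplex, then (iii)$\Rightarrow$(i).
   Context: A C*-dynamical system $(\mathfrak{A}, G, \Theta)$ consists of a unital C*-algebra $\mathfrak{A}$, a topological group $G$, and a group homomorphism $\Theta : G \to \operatorname{Aut}(\mathfrak{A})$ into the *-automorphisms of $\mathfrak{A}$, continuous for the point-norm topology (automatic for discrete $G$). $\mathcal{S}^G$ is the set of $\Theta$-invariant states on $\mathfrak{A}$ (states $\phi$ with $\phi \circ \Theta_g = \phi$ for all $g$), with the weak*-topology. The system is uniquely ergodic if $\mathcal{S}^G$ is a singleton, and strictly ergodic if it is uniquely ergodic and its unique invariant state is faithful. A W*-dynamical system $(\mathfrak{M}, \rho, G, \Xi)$ consists of a von Neumann algebra $\mathfrak{M}$, a faithful normal tracial state $\rho$ on $\mathfrak{M}$, a discrete group $G$, and an action $\Xi$ of $G$ on $\mathfrak{M}$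 by *-automorphisms with $\rho \circ \Xi_g = \rho$ for all $g$. $\mathcal{L}^2(\mathfrak{M}, \rho)$ is the Hilbert space completion of $\mathfrak{M}$ for the inner product $\langle x, y \rangle_\rho = \rho(y^* x)$. A C*-model of $(\mathfrak{M}, \rho, G, \Xi)$ is a quadruple $(\mathfrak{A}, G, \Theta; \iota)$ where $(\mathfrak{A}, G, \Theta)$ is a C*-dynamical system and $\iota : \mathfrak{A} \to \mathfrak{M}$ is a *-homomorphism such that (a) $\iota(\mathfrak{A})$ is dense in $\mathfrak{M}$ in the weak operator topology, (b) $\Xi_g(\iota(\mathfrak{A})) = \iota(\mathfrak{A})$ for all $g \in G$, (c) $\Xi_g \circ \iota = \iota \circ \Theta_g$ for all $g \in G$. It is faithful if $\iota$ is injective. A right Følner sequence for $G$ is a sequence $(F_k)_{k=1}^\infty$ of nonempty finite subsets of $G$ with $|F_k g \Delta F_k|/|F_k| \to 0$ for every $g \in G$. The gauge of a positive $a \in \mathfrak{A}$ is $\Gamma(a) := \lim_{k \to \infty} \left\| \frac{1}{|F_k|} \sum_{g \in F_k} \Theta_g a \right\|$ for a right Følner sequence $(F_k)$; the limit exists and does not depend on the choice of the sequence. A compact convex subset $K$ of a locally convex real topological vector space, contained in a hyperplane not containing the origin, is a simplex if, with $P = \{ck : c \in \mathbb{R}_{\geq 0}, k \in K\}$, the relation $a \leq b \iff b - a \in P$ is a lattice ordering on $P - P$. Here the ambient space is the space of bounded self-adjoint linear functionals on $\mathfrak{A}$ with the weak*-topology. *)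

(* Defs.v *)
From HB Require Import structures.
From mathcomp Require Import all_boot all_order all_algebra finmap.
From mathcomp Require Import complex sesquilinear.
From mathcomp Require Import ring interval_inference.
From mathcomp Require Import all_classical all_reals topology normedtype convex.
Set Implicit Arguments.
Unset Strict Implicit.
Unset Printing Implicit Defensive.
Import Order.TTheory GRing.Theory Num.Theory numFieldNormedType.Exports.
Local Open Scope classical_set_scope.
Local Open Scope convex_scope.
Local Open Scope ring_scope.

Definition separable (T : topologicalType) :=
  exists2 D : set T, countable D & dense D.

Section Groups.
Variables (R : realType) (G : groupType).

(** Existence of a left-invariant mean on the bounded real functions on [G];
    the values of [m] on unbounded functions are irrelevant. *)
Definition amenable :=
  exists m : (G -> R) -> R,
    [/\ forall (c : R) (f h : G -> R), bounded_fun f -> bounded_fun h ->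
          m (fun x => c * f x + h x) = c * m f + m h,
        forall f : G -> R, bounded_fun f -> (forall x, 0 <= f x) -> 0 <= m f,
        m (fun=> 1) = 1
      & forall (g : G) (f : G -> R), bounded_fun f ->
          m (fun x => f (g * x)%g) = m f].

Definition right_folner (F : nat -> {fset G}) :=
  (forall k, F k != fset0) /\
  forall g : G,
    let Fg k := [fset (x * g)%g | x in F k]%fset in
    (fun k => #|` ((Fg k `\` F k) `|` (F k `\` Fg k))%fset |%:R
              / #|` F k|%:R : R) @ \oo --> (0 : R).

End Groups.

(** [K] stands for the field [R[i]] of complex numbers over a [realType]. *)

(** The inner product is linear in its first argument. *)
HB.mixin Record isHilbert (K : numClosedFieldType) H
    & CompleteNormedModule K H := {
  inner : {dot H for @Num.conj K} ;
  inner_norm : forall x : H, inner x x = `|x| ^+ 2 }.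

#[short(type="hilbertType")]
HB.structure Definition Hilbert (K : numClosedFieldType) :=
  {H of CompleteNormedModule K H & isHilbert K H}.

(** The ring operations are part of the mixin since the hierarchy has no join of
    rings and normed modules below the number fields. *)
HB.mixin Record isCStarAlgebra (K : numClosedFieldType) A
    & CompleteNormedModule K A := {
  cone : A ;
  cmul : A -> A -> A ;
  star : A -> A ;
  cmulA : associative cmul ;
  cmul1l : left_id cone cmul ;
  cmul1r : right_id cone cmul ;
  cmulDl : left_distributive cmul +%R ;
  cmulDr : right_distributive cmul +%R ;
  cmulZl : forall (c : K) a b, cmul (c *: a) b = c *: cmul a b ;
  cmulZr : forall (c : K) a b, cmul a (c *: b) = c *: cmul a b ;
  starK : involutive star ;
  starD : {morph star : a b / a + b} ;
  starZ : forall (c : K) a, star (c *: a) = Num.conj c *: star a ;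
  starM : forall a b, star (cmul a b) = cmul (star b) (star a) ;
  cnormM : forall a b : A, `|cmul a b| <= `|a| * `|b| ;
  cnorm_star : forall a : A, `|cmul (star a) a| = `|a| ^+ 2 }.

#[short(type="cstarAlgType")]
HB.structure Definition CStarAlgebra (K : numClosedFieldType) :=
  {A of CompleteNormedModule K A & isCStarAlgebra K A}.

Section Simplex.
Variables (R : realType) (V : tvsType R) (K : set V).

Definition cone_over : set V :=
  [set v | exists c k, [/\ 0 <= c, K k & v = c *: k]].

Definition cone_span : set V :=
  [set v | exists p q, [/\ cone_over p, cone_over q & v = p - q]].

Definition cone_le (a b : V) := cone_over (b - a).

Definition cone_lattice_ordering :=
  [/\ forall a, cone_span a -> cone_le a a,
      forall a b, cone_span a -> cone_span b ->
        cone_le a b -> cone_le b a -> a = b,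
      forall a b c, cone_span a -> cone_span b -> cone_span c ->
        cone_le a b -> cone_le b c -> cone_le a c,
      forall a b, cone_span a -> cone_span b ->
        exists s, [/\ cone_span s, cone_le a s, cone_le b s
          & forall c, cone_span c -> cone_le a c -> cone_le b c -> cone_le s c]
    & forall a b, cone_span a -> cone_span b ->
        exists i, [/\ cone_span i, cone_le i a, cone_le i b
          & forall c, cone_span c -> cone_le c a -> cone_le c b -> cone_le c i]].

(** The third clause says that [K] lies in the hyperplane [f = 1]. *)
Definition simplex :=
  [/\ compact K, convex_set K,
      exists f : {scalar V}, (exists v, f v = 1) /\ (forall k, K k -> f k = 1)
    & cone_lattice_ordering].

End Simplex.

Section Dual.
Variables (R : realType) (A : cstarAlgType R[i]).
Implicit Types (a b : A) (f : A -> R[i]).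

Definition bounded_functional f := exists c : R[i], forall a, `|f a| <= c * `|a|.

Definition selfadjoint_functional f := forall a, f (star a) = Num.conj (f a).

(** The space of bounded self-adjoint functionals, as a real vector space with
    the weak*-topology, is [sa_dual] below. Functionals take values in
    [Rcomplex R], which is [R[i]] as a real vector space. *)
Definition sa_bounded : {pred A -> Rcomplex R} :=
  [pred f | `[< [/\ scalar (f : A -> R[i]), bounded_functional f
                  & selfadjoint_functional f] >]].

Record sa_dual := SaDual {
  sa_val :> A -> Rcomplex R ;
  sa_valP : sa_val \in sa_bounded }.

HB.instance Definition _ := [isSub for sa_val].
HB.instance Definition _ := [Choice of sa_dual by <:].

Lemma sa_bounded_submod : submod_closed sa_bounded.
Proof.
split.
  apply/asboolP; split=> [c a b|| a] /=; first by rewrite mulr0 addr0.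
  - by exists 0 => a; rewrite mul0r normr0.
  - by rewrite rmorph0.
move=> c f g /asboolP[flin [M fM] fsa] /asboolP[glin [N gN] gsa].
have E a : (c *: f + g) a = c%:C%C * f a + g a.
  by rewrite [LHS]/(c *: f a + g a); case: (f a) (g a) => [x y] [z t]; simpc.
apply/asboolP; split.
- by move=> d a b; rewrite !E flin glin; ring.
- exists (`|c%:C%C| * M + N) => a; rewrite E (le_trans (ler_normD _ _))//.
  by rewrite mulrDl normrM -mulrA lerD// ler_wpM2l.
- move=> a; rewrite !E fsa gsa rmorphD rmorphM; congr (_ * _ + _).
  by apply: esym; exact: conjc_real.
Qed.

HB.instance Definition _ :=
  GRing.isSubmodClosed.Build R (A -> Rcomplex R) sa_bounded
    sa_bounded_submod.
HB.instance Definition _ := [SubChoice_isSubLmodule of sa_dual by <:].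

(** The weak*-topology: pointwise convergence on [A]. *)
HB.instance Definition _ := Uniform.copy sa_dual
  (initial_topology (fun f : sa_dual => (f : A -> R[i]) : {ptws A -> R[i]^o})).

Lemma sa_dualD (f g : sa_dual) a : (f + g) a = f a + g a :> R[i].
Proof. by []. Qed.

Lemma sa_dualZ (c : R) (f : sa_dual) a : (c *: f) a = c%:C%C * f a :> R[i].
Proof. by rewrite [LHS]/(c *: f a); case: (f a) => [x y]; simpc. Qed.

Lemma sa_dual_cvg (F : set_system sa_dual) (f : sa_dual) : Filter F ->
  (forall a, (fun g : sa_dual => g a : R[i]^o) @ F --> (f a : R[i]^o)) ->
  F --> f.
Proof.
move=> FF Ff U; rewrite nbhsE => -[V [[B oB <-] /= Bf] BU].
pose ev (g : sa_dual) : {ptws A -> R[i]^o} := (g : A -> R[i]).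
have /(_ B) : ev @ F --> ev f.
  by apply: (proj2 (@pointwise_cvgP A R[i]^o (ev @ F) (ev f) _)) => a; exact: Ff.
move=> /(_ (open_nbhs_nbhs (conj oB Bf))) FB.
exact: (@filterS _ F FF _ _ BU FB).
Qed.

Lemma sa_dual_eval_continuous a : continuous (fun g : sa_dual => g a : R[i]^o).
Proof.
move=> f.
have cev : continuous (fun g : sa_dual =>
    (g : A -> R[i]) : {ptws A -> R[i]^o}) by exact: initial_continuous.
pose ev (g : sa_dual) : {ptws A -> R[i]^o} := (g : A -> R[i]).
refine (proj1 (@pointwise_cvgP A R[i]^o (ev @ f) (ev f) _) (cev f) a).
refine (@fmap_filter _ _ _ _ (nbhs_filter f)).
Qed.

Lemma sa_dual_cvg_eval (T : Type) (F : set_system T) (u : T -> sa_dual)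
  (f : sa_dual) a : u @ F --> f -> (fun t => u t a : R[i]^o) @ F --> (f a : R[i]^o).
Proof. by move=> uf; apply: (cvg_trans _ (@sa_dual_eval_continuous a f)) => V /uf. Qed.

Lemma sa_dual_add_continuous :
  continuous (fun x : sa_dual * sa_dual => x.1 + x.2).
Proof.
move=> x.
have Fx : Filter (nbhs x) by exact: (@nbhs_filter (sa_dual * sa_dual)%type x).
have H (F : set_system (sa_dual * sa_dual)) : Filter F ->
    fst @ F --> x.1 -> snd @ F --> x.2 ->
    (fun y : sa_dual * sa_dual => y.1 + y.2) @ F --> x.1 + x.2.
  move=> FF F1 F2; apply: sa_dual_cvg => a.
  exact: (@cvgD _ R[i]^o _ F FF (fun y => fst y a : R[i]^o)
    (fun y => snd y a : R[i]^o) _ _ (sa_dual_cvg_eval F1) (sa_dual_cvg_eval F2)).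
by apply: H; [exact: cvg_fst|exact: cvg_snd].
Qed.

Lemma real_complex_continuous : continuous (fun c : R^o => c%:C%C : R[i]^o).
Proof.
move=> c; apply/cvgrPdist_lt => -[e ei] /=; rewrite ltcE /= => /andP[/eqP -> e0].
near=> d; rewrite -rmorphB normc_def /= expr0n /= addr0 sqrtr_sqr ltcR.
by near: d; move: e e0; apply/cvgrPdist_lt.
Unshelve. all: by end_near. Qed.

Lemma sa_dual_scale_continuous :
  continuous (fun z : R^o * sa_dual => z.1 *: z.2).
Proof.
move=> x.
have Fx : Filter (nbhs x) by exact: (@nbhs_filter (R^o * sa_dual)%type x).
have H (F : set_system (R^o * sa_dual)) : Filter F ->
    fst @ F --> x.1 -> snd @ F --> x.2 ->
    (fun y : R^o * sa_dual => y.1 *: y.2) @ F --> x.1 *: x.2.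
  move=> FF F1 F2; apply: sa_dual_cvg => a.
  have E : (fun y : R^o * sa_dual => (y.1 *: y.2) a : R[i]^o) =
      (fun y : R^o * sa_dual => y.1%:C%C * (y.2 a : R[i])).
    by apply/funext => y; exact: sa_dualZ.
  change (fmap (fun y : R^o * sa_dual => (y.1 *: y.2) a : R[i]^o) F
    --> ((x.1 *: x.2) a : R[i]^o)).
  rewrite E sa_dualZ.
  have F1' : (fun y : R^o * sa_dual => y.1%:C%C : R[i]^o) @ F --> (x.1%:C%C : R[i]^o).
    move=> V V1; apply: (F1 _ (@real_complex_continuous x.1 V V1)).
  exact: (@cvgM R[i] _ F FF (fun y => (fst y)%:C%C)
    (fun y => snd y a : R[i]^o) _ _ F1' (sa_dual_cvg_eval F2)).
apply: H.
  exact: (@cvg_fst _ _ (nbhs x.1) (nbhs x.2) (nbhs_filter x.2)).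
exact: (@cvg_snd _ _ (nbhs x.1) (nbhs x.2) (nbhs_filter x.1)).
Qed.

Definition sa_box (f : sa_dual) (s : seq A) (e : R) : set sa_dual :=
  [set g : sa_dual | forall a, a \in s -> `|f a - g a : R[i]| < e%:C%C].

Lemma sa_dual_locally_convex : exists2 B : set_system sa_dual,
  (forall U : set sa_dual, U \in B -> convex_set U) & basis B.
Proof.
exists [set U | open U /\ convex_set U]; first by move=> b /set_mem[].
split=> [U []//|f].
pose F := filter_from [set p : seq A * R | 0 < p.2] (fun p => sa_box f p.1 p.2).
have FF : Filter F.
  apply: filter_from_filter; first by exists ([::], 1) => /=.
  move=> [s e] [t d] /= e0 d0; exists (s ++ t, Num.min e d) => /=.
    by rewrite lt_min e0.
  move=> g gst; split=> a ai /=; apply: (lt_le_trans (gst a _));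
    rewrite ?mem_cat ?ai ?orbT// lecR ge_min lexx ?orbT//.
have : F --> f.
  apply: sa_dual_cvg => a; apply/cvgrPdist_lt => -[e ei] /=.
  rewrite ltcE /= => /andP[/eqP -> e0].
  by exists ([:: a], e) => //= g /(_ a); rewrite mem_head; apply.
apply: cvg_trans => U [[s e] /= e0 boxU].
exists (sa_box f s e) => //; split; last first.
  by move=> a _; rewrite subrr normr0 ltcR.
split.
  elim: s {boxU} => [|a s IH].
    rewrite (_ : sa_box _ _ _ = setT); first exact: openT.
    by apply/seteqP; split=> // g _ a.
  have -> : sa_box f (a :: s) e =
      (fun g : sa_dual => g a : R[i]^o) @^-1` ball (f a : R[i]^o) e%:C%C
        `&` sa_box f s e.
    apply/seteqP; split=> [g gas|g [ga gs] b]; last first.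
      by rewrite inE => /orP[/eqP->|/gs].
    split; first by apply: gas; rewrite mem_head.
    by move=> b bs; apply: gas; rewrite inE bs orbT.
  apply: openI IH; apply: open_comp.
    by move=> g _; exact: sa_dual_eval_continuous.
  exact: ball_open.
move=> g h l /set_mem gs /set_mem hs; apply/mem_set => a ai.
have -> : g <| l |> h = l%:num *: g + (1 - l%:num) *: h :> sa_dual by [].
have := gs a ai; have := hs a ai.
have l0 : 0 <= l%:num :> R by [].
have l1 : 0 <= 1 - l%:num :> R by rewrite subr_ge0.
move: (l%:num : R) l0 l1 => t t0 t1.
rewrite sa_dualD !sa_dualZ rmorphB rmorph1.
move: (f a : R[i]) (g a : R[i]) (h a : R[i]) => x y z xz xy.
have -> : x - (t%:C%C * y + (1 - t%:C%C) * z) =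
    t%:C%C * (x - y) + (1 - t%:C%C) * (x - z) by ring.
have T0 : 0 <= t%:C%C :> R[i] by rewrite lecR.
have T1 : 0 <= 1 - t%:C%C :> R[i] by rewrite -[1]/(1%:C%C) -rmorphB lecR.
apply: (le_lt_trans (ler_normD _ _)); rewrite !normrM (ger0_norm T0) (ger0_norm T1).
have [->|tn0] := eqVneq t 0; first by rewrite rmorph0 mul0r subr0 mul1r add0r.
have -> : e%:C%C = t%:C%C * e%:C%C + (1 - t%:C%C) * e%:C%C :> R[i] by ring.
apply: ltr_leD; last by rewrite ler_wpM2l// ltW.
by rewrite ltr_pM2l// lt_neqAle T0 andbT eq_sym (inj_eq (@complexI R)).
Qed.

HB.instance Definition _ :=
  PreTopologicalNmodule_isTopologicalNmodule.Build sa_dual sa_dual_add_continuous.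
HB.instance Definition _ :=
  TopologicalNmodule_isTopologicalLmodule.Build R sa_dual sa_dual_scale_continuous.
HB.instance Definition _ := Uniform_isTvs.Build R sa_dual sa_dual_locally_convex.
End Dual.

Section States.
Variables (K : numClosedFieldType) (A : cstarAlgType K).
Implicit Types (a b : A) (phi : A -> K).

Definition positive_elt a := exists b, a = cmul (star b) b.

Definition state phi :=
  [/\ scalar phi, phi cone = 1 & forall a, positive_elt a -> 0 <= phi a].

Definition faithful_state phi :=
  state phi /\ forall a, positive_elt a -> phi a = 0 -> a = 0.

Definition cstar_automorphism (alpha : A -> A) :=
  [/\ bijective alpha, linear alpha,
      forall a b, alpha (cmul a b) = cmul (alpha a) (alpha b)
    & forall a, alpha (star a) = star (alpha a)].

Variable G : groupType.
Implicit Types (Theta : G -> A -> A).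

(** Point-norm continuity of [Theta] is automatic since [G] is discrete. *)
Definition cstar_system Theta :=
  (forall g, cstar_automorphism (Theta g)) /\
  (forall g h a, Theta (g * h)%g a = Theta g (Theta h a)).

Definition invariant_states Theta : set (A -> K) :=
  [set phi | state phi /\ forall g a, phi (Theta g a) = phi a].

Definition uniquely_ergodic Theta :=
  exists phi, invariant_states Theta = [set phi].

Definition strictly_ergodic Theta :=
  exists2 phi, invariant_states Theta = [set phi] & faithful_state phi.

End States.

Section Gauge.
Variables (R : realType) (A : cstarAlgType R[i]) (G : groupType).
Variables (Theta : G -> A -> A).

Definition gauge (F : nat -> {fset G}) (a : A) : R :=
  lim ((fun k => complex.Re
    `| (#|` F k|%:R : R[i])^-1 *: \sum_(g <- F k) Theta g a |) @ \oo).

(** The invariant states, as a subset of the space of bounded self-adjoint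
    functionals (every state is bounded and self-adjoint). *)
Definition invariant_states_dual : set (sa_dual A) :=
  [set f | invariant_states Theta (f : A -> R[i])].

End Gauge.

Section VonNeumann.
Variables (K : numClosedFieldType) (H : hilbertType K).
Implicit Types (S T : H -> H) (M : set (H -> H)) (rho : (H -> H) -> K).

Definition bounded_operator : set (H -> H) :=
  [set T | linear T /\ exists c : K, forall x, `|T x| <= c * `|x|].

Definition is_adjoint T T' := forall x y, inner (T x) y = inner x (T' y).

(** The weak operator topology, on all functions [H -> H]. *)
Definition wot := initial_topology
  (fun T : H -> H => (fun p => inner (T p.1) p.2) : {ptws (H * H)%type -> K^o}).

Definition wot_closure (X : set (H -> H)) : set (H -> H) :=
  closure (X : set wot) `&` bounded_operator.

Record von_neumann_algebra M : Prop := {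
  vn_bounded : M `<=` bounded_operator ;
  vn_id : M idfun ;
  vn_lin : forall c S T, M S -> M T -> M (c *: S + T) ;
  vn_comp : forall S T, M S -> M T -> M (S \o T) ;
  vn_adj : forall T, M T -> exists2 T', M T' & is_adjoint T T' ;
  vn_closed : wot_closure M `<=` M }.

Definition op_le S T := forall x, 0 <= inner (T x - S x) x.

Definition op_positive T := forall x, 0 <= inner (T x) x.

(** [rho] preserves suprema of bounded increasing nets of positive elements. *)
Definition normal M rho :=
  forall (D : set (H -> H)) T,
    D !=set0 -> D `<=` M `&` op_positive ->
    (forall S1 S2, D S1 -> D S2 ->
      exists S3, [/\ D S3, op_le S1 S3 & op_le S2 S3]) ->
    M T -> is_adjoint T T ->
    (forall S, D S -> op_le S T) ->
    (forall T', M T' -> is_adjoint T' T' ->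
      (forall S, D S -> op_le S T') -> op_le T T') ->
    supremums (rho @` D) (rho T).

Record faithful_normal_tracial_state M rho : Prop := {
  fnt_lin : forall c S T, M S -> M T -> rho (c *: S + T) = c * rho S + rho T ;
  fnt_id : rho idfun = 1 ;
  fnt_pos : forall T, M T -> op_positive T -> 0 <= rho T ;
  fnt_faithful : forall T, M T -> op_positive T -> rho T = 0 -> T = 0 ;
  fnt_normal : normal M rho ;
  fnt_trace : forall S T, M S -> M T -> rho (S \o T) = rho (T \o S) }.

Record vn_automorphism M (alpha : (H -> H) -> (H -> H)) : Prop := {
  vna_bij : set_bij M M alpha ;
  vna_lin : forall c S T, M S -> M T ->
    alpha (c *: S + T) = c *: alpha S + alpha T ;
  vna_comp : forall S T, M S -> M T -> alpha (S \o T) = alpha S \o alpha T ;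
  vna_adj : forall T T', M T -> M T' ->
    is_adjoint T T' -> is_adjoint (alpha T) (alpha T') }.

Record wstar_system (G : groupType) M rho (Xi : G -> (H -> H) -> (H -> H))
    : Prop := {
  wsys_vn : von_neumann_algebra M ;
  wsys_state : faithful_normal_tracial_state M rho ;
  wsys_aut : forall g, vn_automorphism M (Xi g) ;
  wsys_act : forall g h T, M T -> Xi (g * h)%g T = Xi g (Xi h T) ;
  wsys_inv : forall g T, M T -> rho (Xi g T) = rho T }.

(** [L], with the canonical map [Lambda] from [M], is the completion of [M] for
    the inner product [<S, T> = rho (T^* S)]. *)
Definition is_L2 M rho (L : hilbertType K) (Lambda : (H -> H) -> L) :=
  [/\ forall c S T, M S -> M T ->
        Lambda (c *: S + T) = c *: Lambda S + Lambda T,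
      forall S T T', M S -> M T -> M T' -> is_adjoint T T' ->
        inner (Lambda S) (Lambda T) = rho (T' \o S)
    & dense (Lambda @` M)].

Variable A : cstarAlgType K.

Record star_homomorphism M (iota : A -> (H -> H)) : Prop := {
  sh_in : forall a, M (iota a) ;
  sh_lin : forall c a b, iota (c *: a + b) = c *: iota a + iota b ;
  sh_mul : forall a b, iota (cmul a b) = iota a \o iota b ;
  sh_star : forall a, is_adjoint (iota a) (iota (star a)) }.

Record cstar_model (G : groupType) M (Xi : G -> (H -> H) -> (H -> H))
    (Theta : G -> A -> A) (iota : A -> (H -> H)) : Prop := {
  cm_sys : cstar_system Theta ;
  cm_hom : star_homomorphism M iota ;
  cm_dense : M `<=` wot_closure (range iota) ;
  cm_range : forall g, Xi g @` range iota = range iota ;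
  cm_equiv : forall g a, Xi g (iota a) = iota (Theta g a) }.

Definition faithful_cstar_model (G : groupType) M
    (Xi : G -> (H -> H) -> (H -> H)) (Theta : G -> A -> A)
    (iota : A -> (H -> H)) :=
  cstar_model M Xi Theta iota /\ injective iota.

End VonNeumann.

(* Main.v *)
(** The state [phi := rho \o iota] is invariant, and faithful because [iota] is
    injective, so it is the only candidate for the unique invariant state.

    For positive [a], every invariant state [chi] satisfies
    [chi a = chi (average F_k a) <= |average F_k a|], and some invariant state
    [psi] attains the limit of these norms. To get [psi], let [upper_mean x] be
    the infimum of the [t] such that, eventually in [k], every positive functional
    [w] has [w (average F_k (x + x^* )) <= t w(1)]. This is sublinear, so
    Hahn-Banach gives a linear functional below it that agrees with it at [a]; the
    Folner property makes it invariant. That the order bound controls the norm,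
    [0 <= x <= t] implying [|x| <= t], follows from square roots in the algebra,
    where [phi], being faithful, shows that the negative part of an element that is
    nonnegative on all positive functionals vanishes.

    Hence [gauge a = psi a] for some invariant [psi], which is [phi] under unique
    ergodicity. Conversely, if [gauge = phi] on positive elements then every
    invariant state is at most [phi] there, and two states so ordered are equal. *)

Require Import Defs.
From HB Require Import structures.
From mathcomp Require Import all_boot all_order all_algebra finmap.
From mathcomp Require Import complex sesquilinear ring lra.
From mathcomp Require Import all_classical all_reals topology normedtype convex.
From mathcomp Require Import sequences.
Set Implicit Arguments.
Unset Strict Implicit.
Unset Printing Implicit Defensive.
Import Order.TTheory GRing.Theory Num.Theory numFieldNormedType.Exports.
Local Open Scope classical_set_scope.
Local Open Scope ring_scope.

(** * Algebra and norm estimates in a C*-algebra *)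

Section CStarBasics.
Variables (K : numClosedFieldType) (A : cstarAlgType K).
Implicit Types a b c v x y : A.

Lemma cmul0l a : cmul 0 a = 0.
Proof. by apply: (addrI (cmul 0 a)); rewrite -cmulDl !addr0. Qed.

Lemma cmul0r a : cmul a 0 = 0.
Proof. by apply: (addrI (cmul a 0)); rewrite -cmulDr !addr0. Qed.

Lemma cmulNl a b : cmul (- a) b = - cmul a b.
Proof. by rewrite -scaleN1r cmulZl scaleN1r. Qed.

Lemma cmulNr a b : cmul a (- b) = - cmul a b.
Proof. by rewrite -scaleN1r cmulZr scaleN1r. Qed.

Lemma star0 : star 0 = 0 :> A.
Proof. by apply: (addrI (star 0)); rewrite -starD !addr0. Qed.

Lemma starN a : star (- a) = - star a.
Proof. by rewrite -scaleN1r starZ rmorphN rmorph1 scaleN1r. Qed.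

Lemma star1 : star cone = cone :> A.
Proof. by rewrite -[star cone]cmul1r -{2}[cone]starK -starM cmul1r starK. Qed.

(** The C*-identity bounds the squared norm of [b] by the product of the norms of [star b] and [b];
    after cancelling, the reverse inequality follows since [star] is an involution. *)
Lemma norm_star a : `|star a| = `|a|.
Proof.
suff H b : `|b| <= `|star b|.
  by apply/eqP; rewrite eq_le H -{2}[a]starK H.
have [->|b0] := eqVneq b 0; first by rewrite normr0.
have : `|b| * `|b| <= `|star b| * `|b| by rewrite -expr2 -cnorm_star cnormM.
by rewrite ler_pM2r// normr_gt0.
Qed.

(** The C*-identity makes this norm idempotent, hence 0 or 1; it is 0 in the zero algebra. *)
Lemma norm_cone_le1 : `|cone : A| <= 1.
Proof.
have : `|cone : A| ^+ 2 = `|cone : A| by rewrite -cnorm_star star1 cmul1l.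
have [->//|n0 E] := eqVneq `|cone : A| 0.
suff -> : `|cone : A| = 1 by [].
by apply: (mulfI n0); rewrite mulr1.
Qed.

Lemma cnorm_sqr c : star c = c -> `|cmul c c| = `|c| ^+ 2.
Proof. by move=> cs; rewrite -{1}cs cnorm_star. Qed.

Lemma cmul_sa_eq0 c : star c = c -> cmul c c = 0 -> c = 0.
Proof.
move=> cs c0; apply/eqP; rewrite -normr_eq0 -sqrf_eq0 -cnorm_sqr// c0.
by rewrite normr0.
Qed.

(** A commuting self-adjoint pair is dominated by the normal element [c + i d]. *)
Lemma norm_sqr_le_sum_sqr c d (t : K) : 0 <= t -> star c = c -> star d = d ->
  cmul c d = cmul d c -> cmul c c + cmul d d = t *: cone -> `|cmul c c| <= t.
Proof.
move=> t0 cs ds cd cdt.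
pose w := c + 'i *: d.
have ws : star w = c - 'i *: d.
  by rewrite /w starD starZ conjCi cs ds scaleNr.
have wE : cmul (star w) w = t *: cone.
  rewrite ws /w cmulDl !cmulDr cmulNl cmulNl !cmulZl !cmulZr cd scalerA.
  rewrite -expr2 sqrCi scaleN1r opprK -cdt.
  by rewrite addrA addrK.
have wt : `|w| ^+ 2 <= t.
  rewrite -cnorm_star wE normrZ ger0_norm//.
  by rewrite -[leRHS]mulr1 ler_wpM2l// norm_cone_le1.
have c2 : 2%:R *: c = w + star w.
  by rewrite ws /w addrACA subrr addr0 scaler_nat mulr2n.
have cw : `|c| <= `|w|.
  have : `|2%:R *: c| <= 2%:R * `|w|.
    by rewrite c2 (le_trans (ler_normD _ _))// norm_star mulr_natl mulr2n.
  by rewrite normrZ ger0_norm// ler_pM2l.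
by rewrite cnorm_sqr// (le_trans _ wt)// ler_sqr ?nnegrE.
Qed.

End CStarBasics.

(** * Real values of complex norms, and limits by majorants *)

Section RealComplex.
Variable R : realType.

Lemma ge0_ReE (z : R[i]) : 0 <= z -> (complex.Re z)%:C%C = z.
Proof. by move=> /ger0_real; exact: RRe_real. Qed.

Lemma normcE (V : normedModType R[i]) (x : V) :
  `|x| = (complex.Re `|x|)%:C%C.
Proof. by rewrite ge0_ReE. Qed.

End RealComplex.

Section Majorant.
Variables (R : realType) (V : completeNormedModType R[i]).

(** [z] is nondecreasing and bounded, hence convergent, and its increments dominate those of [u], so
    [u] is Cauchy. *)
Lemma majorized_cvg (u : nat -> V) (z : nat -> R) :
  (forall n, `|u n.+1 - u n| <= (z n.+1 - z n)%:C%C) ->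
  (forall n, z n <= 1) ->
  exists l, forall e : R, 0 < e ->
    exists n, forall m, (n <= m)%N -> `|u m - l| <= e%:C%C.
Proof.
move=> uz z1.
have zinc : nondecreasing_seq z.
  apply/nondecreasing_seqP => n; rewrite -subr_ge0 -lecR.
  exact: le_trans (normr_ge0 _) (uz n).
have uz' m n : (m <= n)%N -> `|u n - u m| <= (z n - z m)%:C%C.
  move=> /subnK <-; elim: (n - m)%N => [|k IH]; first by rewrite add0n !subrr normr0.
  rewrite addSn -[u _](subrK (u (k + m)%N)) -addrA (le_trans (ler_normD _ _))//.
  by rewrite -[z _](subrK (z (k + m)%N)) -addrA rmorphD lerD.
have zc : cvgn z by apply: nondecreasing_is_cvgn => //; exists 1 => _ [n _ <-].
have zC (e : R) : 0 < e -> exists n, forall m, (n <= m)%N -> z m - z n < e.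
  move=> e0; have /cvgrPdist_lt /(_ e e0) [n _ nP] := zc.
  exists n => m nm; apply: le_lt_trans (nP n (leqnn n)).
  apply: le_trans (ler_norm _); rewrite lerD2r.
  exact: nondecreasing_cvgn_le.
have uc : cauchy (u @ \oo).
  apply: cauchy_exP => -[e ei]; rewrite ltcE /= => /andP[/eqP -> e0].
  have [n nP] := zC e e0.
  exists (u n); exists n => // m /= nm.
  rewrite -ball_normE /= distrC (le_lt_trans (uz' _ _ nm))// ltcR.
  exact: nP.
exists (lim (u @ \oo)) => e e0.
have ul : u @ \oo --> lim (u @ \oo) by exact: cauchy_cvg.
have e0' : 0 < e%:C%C :> R[i] by rewrite ltcR.
move/cvgrPdist_le : ul => /(_ _ e0') [n _ nP].
by exists n => m nm; rewrite distrC; exact: nP.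
Qed.

End Majorant.

Lemma le0_eps (R : realType) (V : normedModType R[i]) (x : V) (M : R) :
  (forall e : R, 0 < e -> `|x| <= (M * e)%:C%C) -> x = 0.
Proof.
move=> xM; apply/eqP; rewrite -normr_le0 normcE lecR.
apply/ler_addgt0Pl => e e0; rewrite addr0.
have M0 : 0 <= M.
  by have := xM 1 ltr01; rewrite mulr1 => /(le_trans (normr_ge0 _)); rewrite lecR.
(* Dividing by [M + 1] also covers [M = 0]. *)
have M1 : 0 < M + 1 by lra.
have := xM _ (divr_gt0 e0 M1); rewrite {1}normcE lecR => /le_trans; apply.
by rewrite mulrA ler_pdivrMr//; nra.
Qed.

(** * Square roots and their commutation properties *)

Section SquareRoot.
Variables (R : realType) (A : cstarAlgType R[i]).
Implicit Types a b c v x y : A.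

(** Replaces functional calculus: of a root of [y], it is enough to know that it commutes with
    whatever commutes with [y]. *)
Definition in_bicommutant (x y : A) :=
  forall v, cmul v y = cmul y v -> cmul v x = cmul x v.

(** Fixed-point iteration for [z = (y + z ^ 2) / 2], which is solved by
    [z = 1 - sqrt (1 - y)]. Its increments are dominated by those of the same
    iteration for the number [y = 1]. *)
Fixpoint sqrt_iter (y : A) n : A :=
  if n is n'.+1 then 2^-1 *: (y + cmul (sqrt_iter y n') (sqrt_iter y n')) else 0.

Fixpoint sqrt_majorant n : R :=
  if n is n'.+1 then (1 + sqrt_majorant n' ^+ 2) / 2 else 0.

Lemma sqrt_majorant_itv n : 0 <= sqrt_majorant n <= 1.
Proof. by elim: n => [|n /= /andP[h0 h1]]; [rewrite lexx ler01|nra]. Qed.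

Lemma sqrt_iter_le y n : `|y| <= 1 -> `|sqrt_iter y n| <= (sqrt_majorant n)%:C%C.
Proof.
move=> y1; elim: n => [|n IH]; first by rewrite /= normr0.
rewrite /= normrZ rmorphM mulrC ger0_norm ?invr_ge0//.
rewrite fmorphV rmorph_nat ler_wpM2r ?invr_ge0//.
rewrite (le_trans (ler_normD _ _))// rmorphD lerD// rmorphXn/=.
by rewrite (le_trans (cnormM _ _))// expr2 ler_pM.
Qed.

(** In the algebra and for scalars alike, half the difference of the squares of [b] and [a] is
    [(b (b - a) + (b - a) a) / 2], an identity valid without commutation; the bounds then propagate
    termwise. *)
Lemma sqrt_iterB_le y n : `|y| <= 1 ->
  `|sqrt_iter y n.+1 - sqrt_iter y n| <= (sqrt_majorant n.+1 - sqrt_majorant n)%:C%C.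
Proof.
move=> y1; elim: n => [|n IH].
  rewrite /= cmul0l addr0 !subr0 normrZ ger0_norm ?invr_ge0//.
  rewrite expr0n/= addr0 mul1r fmorphV rmorph_nat.
  by rewrite -[leRHS]mulr1 ler_wpM2l ?invr_ge0.
have -> : sqrt_majorant n.+2 - sqrt_majorant n.+1 =
   (sqrt_majorant n.+1 * (sqrt_majorant n.+1 - sqrt_majorant n)
   + (sqrt_majorant n.+1 - sqrt_majorant n) * sqrt_majorant n) / 2.
  by rewrite /=; field.
move: (sqrt_iter_le n y1) (sqrt_iter_le n.+1 y1) IH.
move: (sqrt_majorant n) (sqrt_majorant n.+1) => p q.
have -> : sqrt_iter y n.+2 - sqrt_iter y n.+1 =
  2^-1 *: (cmul (sqrt_iter y n.+1) (sqrt_iter y n.+1 - sqrt_iter y n)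
   + cmul (sqrt_iter y n.+1 - sqrt_iter y n) (sqrt_iter y n)).
  rewrite [sqrt_iter y n.+2]/= {3}[sqrt_iter y n.+1]/= -scalerBr; congr (_ *: _).
  rewrite cmulDr cmulDl cmulNl cmulNr opprD addrACA subrr add0r.
  by rewrite addrA subrK.
move: (sqrt_iter y n) (sqrt_iter y n.+1) => a b ap bq abqp.
rewrite normrZ rmorphM mulrC ger0_norm ?invr_ge0//.
rewrite fmorphV rmorph_nat ler_wpM2r ?invr_ge0//.
rewrite (le_trans (ler_normD _ _))// rmorphD lerD// rmorphM/=.
  by rewrite (le_trans (cnormM _ _))// ler_pM.
by rewrite (le_trans (cnormM _ _))// ler_pM.
Qed.

Lemma sqrt_iter_sa y n : star y = y -> star (sqrt_iter y n) = sqrt_iter y n.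
Proof.
move=> ys; elim: n => [|n IH] /=; first exact: star0.
by rewrite starZ fmorphV rmorph_nat starD ys starM IH.
Qed.

Lemma sqrt_iter_commutes y n : in_bicommutant (sqrt_iter y n) y.
Proof.
move=> v vy; elim: n => [|n IH] /=; first by rewrite cmul0l cmul0r.
by rewrite cmulZl cmulZr cmulDl cmulDr vy cmulA IH -cmulA IH cmulA.
Qed.

(** The root is [cone - z] for the limit [z] of the iteration, as [2 *: z = y + cmul z z]. The bound
    on [cone - s] allows the lemma to be applied again, to [cone - s], which gives a root of [s]. *)
Lemma sqrt_1B y : star y = y -> `|y| <= 1 ->
  exists s, [/\ star s = s, cmul s s = cone - y, `|cone - s| <= 1 & in_bicommutant s y].
Proof.
move=> ys y1.
have [z zP] := majorized_cvg (fun n => sqrt_iterB_le n y1)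
   (fun n => proj2 (andP (sqrt_majorant_itv n))).
have z1 : `|z| <= 1.
  rewrite normcE (lecR _ 1); apply/ler_addgt0Pr => e e0.
  have [n /(_ n (leqnn n)) nP] := zP e e0.
  rewrite -lecR -normcE -[z](subKr (sqrt_iter y n)) rmorphD.
  rewrite (le_trans (ler_normB _ _))// lerD//.
  rewrite (le_trans (sqrt_iter_le n y1))// (lecR _ 1).
  by case/andP: (sqrt_majorant_itv n).
have zs : star z = z.
  apply/eqP; rewrite -subr_eq0; apply/eqP/(@le0_eps _ _ _ 2) => e e0.
  have [n /(_ n (leqnn n)) nP] := zP e e0.
  rewrite mulr_natl mulr2n rmorphD -(subrK (sqrt_iter y n) (star z)) -addrA.
  rewrite (le_trans (ler_normD _ _))// lerD//.
  by rewrite -{1}(sqrt_iter_sa n ys) -starN -starD norm_star distrC.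
have zE : 2 *: z = y + cmul z z.
  (* Limit of the recursion: the error is [2 * e] from [2 *: z], plus [e] from each of the two terms
     into which the difference of squares splits. *)
  apply/eqP; rewrite -subr_eq0; apply/eqP/(@le0_eps _ _ _ 4) => e e0.
  have [n nP] := zP e e0.
  have {}nP := (nP n (leqnn n), nP n.+1 (leqnSn n)).
  rewrite -(subrK (2 *: sqrt_iter y n.+1) (2 *: z)) -addrA.
  rewrite -scalerBr.
  rewrite {2}[sqrt_iter y n.+1]/= scalerA divff ?pnatr_eq0// scale1r.
  rewrite opprD addrACA subrr add0r.
  have -> : cmul (sqrt_iter y n) (sqrt_iter y n) - cmul z z =
    cmul (sqrt_iter y n) (sqrt_iter y n - z) + cmul (sqrt_iter y n - z) z.
    by rewrite cmulDr cmulDl cmulNr cmulNl addrA subrK.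
  have -> : 4 * e = 2 * e + (e + e) by ring.
  rewrite (le_trans (ler_normD _ _))// rmorphD lerD//.
    rewrite normrZ ger0_norm// rmorphM rmorph_nat ler_wpM2l// distrC.
    exact: nP.2.
  rewrite (le_trans (ler_normD _ _))// rmorphD lerD//.
    rewrite (le_trans (cnormM _ _))// -[leRHS]mul1r ler_pM// ?nP.1//.
    rewrite (le_trans (sqrt_iter_le n y1))// (lecR _ 1).
    by case/andP: (sqrt_majorant_itv n).
  by rewrite (le_trans (cnormM _ _))// -[leRHS]mulr1 ler_pM// nP.1.
have zc : in_bicommutant z y.
  move=> v vy.
  apply/eqP; rewrite -subr_eq0; apply/eqP.
  apply: (@le0_eps _ _ _ (complex.Re `|v| + complex.Re `|v|)) => e e0.
  have [n /(_ n (leqnn n)) nP] := zP e e0.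
  rewrite -(subrK (cmul v (sqrt_iter y n)) (cmul v z)) -addrA.
  rewrite [in X in _ + X](sqrt_iter_commutes n vy).
  rewrite -cmulNr -cmulDr -cmulNl -cmulDl mulrDl rmorphD rmorphM/= ge0_ReE//.
  rewrite (le_trans (ler_normD _ _))// lerD//.
    by rewrite (le_trans (cnormM _ _))// ler_wpM2l// distrC.
  by rewrite (le_trans (cnormM _ _))// mulrC ler_wpM2l.
exists (cone - z); split.
- by rewrite starD starN star1 zs.
- rewrite cmulDl !cmulDr cmul1l cmulNl cmul1l cmulNr cmulNl cmul1r opprK.
  rewrite addrA -(addrA cone) -opprD -mulr2n -scaler_nat zE.
  by rewrite opprD addrA subrK.
- by rewrite opprD addrA subrr add0r opprK.
- by move=> v vy; rewrite cmulDr cmulDl cmul1r cmul1l cmulNr cmulNl (zc v vy).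
Qed.

Lemma in_bicommutant_trans x y v : in_bicommutant x y -> in_bicommutant y v ->
  in_bicommutant x v.
Proof. by move=> xy yv w /yv/xy. Qed.

Lemma in_bicommutant_1B x : in_bicommutant (cone - x) x.
Proof. by move=> v vx; rewrite cmulDr cmulDl cmul1r cmul1l cmulNr cmulNl vx. Qed.

Lemma in_bicommutant_sqr x : in_bicommutant (cmul x x) x.
Proof. by move=> v vx; rewrite cmulA vx -cmulA vx cmulA. Qed.

(** [cmul c c] is the absolute value of [h]. *)
Lemma abs_sqrt h : star h = h -> `|h| <= 1 ->
  exists c, [/\ star c = c, cmul (cmul c c) (cmul c c) = cmul h h & in_bicommutant c h].
Proof.
move=> hs h1.
have hhs : star (cmul h h) = cmul h h by rewrite starM hs.
have hh1 : `|cmul h h| <= 1 by rewrite cnorm_sqr// expr_le1.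
(* [h] and [v] are the sine and cosine of a unitary, so [|1 - h ^ 2| <= 1]. *)
have [v [vs vv _ vc]] := sqrt_1B hhs hh1.
have {}vc := in_bicommutant_trans vc (@in_bicommutant_sqr h).
have vvs : star (cmul v v) = cmul v v by rewrite starM vs.
have vv1 : `|cmul v v| <= 1.
  apply: (@norm_sqr_le_sum_sqr _ _ v h) => //; first by rewrite (vc h).
  by rewrite vv subrK scale1r.
(* [k] squares to [cone - cmul v v], that is to [cmul h h]; the root [c] of [k] is then obtained by
   writing [k] as [cone - (cone - k)]. *)
have [k [ks kk k1 kc]] := sqrt_1B vvs vv1.
have {}kc := in_bicommutant_trans kc (in_bicommutant_trans (@in_bicommutant_sqr v) vc).
have ks' : star (cone - k) = cone - k by rewrite starD starN star1 ks.
have [c [cs cc _ ccom]] := sqrt_1B ks' k1.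
rewrite opprB addrC subrK in cc.
exists c; split => //; first by rewrite cc kk vv opprB addrC subrK.
exact: in_bicommutant_trans ccom (in_bicommutant_trans (@in_bicommutant_1B k) kc).
Qed.

End SquareRoot.

(** * Linear and positive functionals *)

Section ScalarFunctions.
Variables (K : numClosedFieldType) (A : lmodType K) (w : A -> K).
Hypothesis wl : scalar w.

Lemma scalarfD x y : w (x + y) = w x + w y.
Proof. by rewrite -[x]scale1r wl mul1r scale1r. Qed.

Lemma scalarf0 : w 0 = 0.
Proof. by apply: (addrI (w 0)); rewrite -scalarfD !addr0. Qed.

Lemma scalarfZ c x : w (c *: x) = c * w x.
Proof. by rewrite -[c *: x]addr0 wl scalarf0 addr0. Qed.

Lemma scalarfN x : w (- x) = - w x.
Proof. by rewrite -scaleN1r scalarfZ mulN1r. Qed.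

Lemma scalarfB x y : w (x - y) = w x - w y.
Proof. by rewrite scalarfD scalarfN. Qed.

Lemma scalarf_sum (I : Type) (r : seq I) (P : pred I) (F : I -> A) :
  w (\sum_(i <- r | P i) F i) = \sum_(i <- r | P i) w (F i).
Proof. exact: (big_morph w scalarfD scalarf0). Qed.

End ScalarFunctions.

Section PositiveFunctionals.
Variables (K : numClosedFieldType) (A : cstarAlgType K).
Implicit Types (a b c x : A) (w : A -> K).

Definition positive_functional w :=
  scalar w /\ forall a, positive_elt a -> 0 <= w a.

Lemma state_positive_functional w : state w -> positive_functional w.
Proof. by case. Qed.

Lemma positive_elt_sa a : positive_elt a -> star a = a.
Proof. by case=> b ->; rewrite starM starK. Qed.

Lemma positive_elt_cone : positive_elt (cone : A).
Proof. by exists cone; rewrite cmul1r star1. Qed.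

Lemma positive_elt_sqr c : star c = c -> positive_elt (cmul c c).
Proof. by move=> cs; exists c; rewrite cs. Qed.

(** Compression sends [star a * a] to [star (a b) * (a b)]. It serves to test an element against its
    own negative part. *)
Lemma positive_functional_compress w b : positive_functional w ->
  positive_functional (fun x => w (cmul (star b) (cmul x b))).
Proof.
move=> [wl w0]; split.
  by move=> c x y; rewrite cmulDl cmulZl cmulDr cmulZr wl.
move=> _ [a ->]; apply: w0; exists (cmul a b).
by rewrite starM !cmulA.
Qed.

End PositiveFunctionals.

(** * Order tested on positive functionals, and the norm *)

Section OrderAndNorm.
Variables (R : realType) (A : cstarAlgType R[i]).
Implicit Types (a b c h x y : A) (phi w : A -> R[i]).

(** Once [y] is scaled to norm 1, [cone - y] is the square of a self-adjoint element, so [w] is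
    nonnegative on it. *)
Lemma positive_functional_le w y : positive_functional w -> star y = y ->
  w y <= `|y| * w cone.
Proof.
move=> [wl w0] ys.
have [y0|y0] := eqVneq `|y| 0.
  by move/normr0_eq0: (y0) => ->; rewrite normr0 mul0r (scalarf0 wl).
have ys' : star (`|y|^-1 *: y) = `|y|^-1 *: y.
  by rewrite starZ ys geC0_conj// invr_ge0.
have y1 : `|(`|y|^-1 *: y)| <= 1 by rewrite normrZ normfV normr_id mulVf.
have [s [ss sE _ _]] := sqrt_1B ys' y1.
have := w0 _ (positive_elt_sqr ss).
rewrite sE (scalarfB wl) (scalarfZ wl) subr_ge0 mulrC ler_pdivrMr 1?mulrC//.
by rewrite lt_def y0 normr_ge0.
Qed.

Lemma positive_functional_norm_le w y : positive_functional w -> star y = y ->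
  - (`|y| * w cone) <= w y <= `|y| * w cone.
Proof.
move=> wp ys; rewrite positive_functional_le// andbT lerNl.
by rewrite -(scalarfN wp.1) -normrN positive_functional_le// starN ys.
Qed.

(** With [k] the absolute value of [h], faithfulness of [phi] forces [k - h] to vanish, so the root
    [c] of [k] is a root of [h]. *)
Lemma sqrt_of_nonneg phi h : faithful_state phi -> star h = h ->
  (forall w, positive_functional w -> 0 <= w h) ->
  exists c, [/\ star c = c, cmul c c = h & in_bicommutant c h].
Proof.
move=> [phis phi_faithful].
wlog h1 : h / `|h| <= 1.
  move=> H hs hp; have [/eqP|h0] := eqVneq `|h| 0.
    by rewrite normr_eq0 => /eqP ->; exists 0; split; rewrite ?star0 ?cmul0l.
  have hs' : star (`|h|^-1 *: h) = `|h|^-1 *: h.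
    by rewrite starZ hs geC0_conj// invr_ge0.
  have h1 : `|(`|h|^-1 *: h)| <= 1 by rewrite normrZ normfV normr_id mulVf.
  have hp' w : positive_functional w -> 0 <= w (`|h|^-1 *: h).
    by move=> wp; rewrite (scalarfZ wp.1) mulr_ge0 ?invr_ge0// hp.
  have [c [cs cc ch]] := H _ h1 hs' hp'.
  exists (sqrtC `|h| *: c); split.
  - by rewrite starZ cs geC0_conj// sqrtC_ge0.
  - by rewrite cmulZl cmulZr cc !scalerA -expr2 sqrtCK divff// scale1r.
  - move=> v vh; rewrite cmulZl cmulZr ch//.
    by rewrite cmulZl cmulZr vh.
move=> hs hp.
have [c [cs kk ch]] := abs_sqrt hs h1.
pose k := cmul c c.
have kh : cmul h k = cmul k h by rewrite cmulA ch// -cmulA ch// cmulA.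
have ks : star k = k by rewrite starM cs.
(* [n] is twice the negative part of [h]. *)
pose n := k - h.
have ns : star n = n by rewrite starD starN ks hs.
have hn : cmul h n = - cmul k n.
  apply/eqP; rewrite -subr_eq0 opprK -cmulDl addrC.
  by rewrite cmulDl !cmulDr !cmulNr kk kh addrA subrK subrr.
have cn0 : cmul c n = 0.
  suff cn : cmul (star (cmul c n)) (cmul c n) = 0.
    by apply/eqP; rewrite -normr_eq0 -sqrf_eq0 -cnorm_star cn normr0.
  apply: phi_faithful; first by exists (cmul c n).
  (* The compression of [phi] by [n] is nonnegative at [h], but [n h n = - n k n] is minus the
     positive element in question. *)
  have := hp _ (positive_functional_compress n (state_positive_functional phis)).
  case: phis => phil _ phip.
  have E : cmul (star (cmul c n)) (cmul c n) = cmul n (cmul k n).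
    by rewrite starM cs ns !cmulA.
  rewrite ns hn cmulNr (scalarfN phil) -E oppr_ge0 => le0.
  by apply/le_anti; rewrite le0 phip//; exists (cmul c n).
have n0 : n = 0.
  (* [n n = k n - h n = 2 k n], and [k n = c (c n) = 0]. *)
  apply: cmul_sa_eq0 => //; rewrite {1}/n cmulDl cmulNl hn opprK /k -cmulA cn0.
  by rewrite cmul0r addr0.
exists c; split => //; apply/eqP; rewrite -subr_eq0 -/k -/n n0//.
Qed.

(** Take roots [c] of [x] and [d] of [t *: cone - x]. As [x] commutes with [t *: cone - x], it
    commutes with [d], so [d] commutes with [c]; their squares add up to [t *: cone]. *)
Lemma norm_le_of_functionals phi x t : faithful_state phi -> star x = x ->
  0 <= t -> (forall w, positive_functional w -> 0 <= w x <= t * w cone) ->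
  `|x| <= t.
Proof.
move=> phif xs t0 xt.
have [c [cs cc cx]] := sqrt_of_nonneg phif xs (fun w wp => proj1 (andP (xt w wp))).
have txs : star (t *: cone - x) = t *: cone - x.
  by rewrite starD starN starZ star1 xs geC0_conj.
have [w wp|d [ds dd dx]] := sqrt_of_nonneg phif txs.
  rewrite (scalarfB wp.1) (scalarfZ wp.1) subr_ge0.
  by case/andP: (xt w wp).
have xd : cmul x d = cmul d x.
  by apply: dx; rewrite cmulDr cmulDl cmulZr cmulZl cmul1l cmul1r cmulNl cmulNr.
rewrite -cc; apply: (norm_sqr_le_sum_sqr t0 cs ds); first by rewrite (cx d).
by rewrite cc dd addrC subrK.
Qed.

End OrderAndNorm.

(** * Averages of the action over finite sets *)

Section Averages.
Variables (K : numClosedFieldType) (A : cstarAlgType K) (G : groupType).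
Variable Theta : G -> A -> A.
Hypothesis Theta_sys : cstar_system Theta.
Implicit Types (F : {fset G}) (x y : A) (w : A -> K) (g h : G).

Definition average F x : A :=
  (#|` F|%:R : K)^-1 *: \sum_(g <- F) Theta g x.

Lemma actD g x y : Theta g (x + y) = Theta g x + Theta g y.
Proof. by case: (Theta_sys.1 g) => _ l _ _; rewrite -[x]scale1r l !scale1r. Qed.

Lemma actP g c x y : Theta g (c *: x + y) = c *: Theta g x + Theta g y.
Proof. by case: (Theta_sys.1 g) => _ l _ _; rewrite l. Qed.

Lemma act0 g : Theta g 0 = 0.
Proof. by apply: (addrI (Theta g 0)); rewrite -actD !addr0. Qed.

Lemma actZ g c x : Theta g (c *: x) = c *: Theta g x.
Proof. by rewrite -[c *: x]addr0 actP act0 addr0. Qed.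

Lemma actN g x : Theta g (- x) = - Theta g x.
Proof. by rewrite -scaleN1r actZ scaleN1r. Qed.

(** By multiplicativity [Theta g cone] is a unit for the range of [Theta g], which is all of [A]. *)
Lemma act_cone g : Theta g cone = cone.
Proof.
case: (Theta_sys.1 g) => -[f fK Kf] _ m _.
by rewrite -[LHS]cmul1r -[X in cmul _ X](Kf cone) -m cmul1l.
Qed.

Lemma act_star g x : Theta g (star x) = star (Theta g x).
Proof. by case: (Theta_sys.1 g). Qed.

Lemma averageP F c x y : average F (c *: x + y) = c *: average F x + average F y.
Proof.
rewrite /average; under eq_bigr do rewrite actP.
rewrite big_split /= -scaler_sumr scalerDr; congr (_ + _).
by rewrite !scalerA mulrC.
Qed.

Lemma averageD F x y : average F (x + y) = average F x + average F y.
Proof. by rewrite -[x]scale1r averageP !scale1r. Qed.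

Lemma averageZ F c x : average F (c *: x) = c *: average F x.
Proof.
have a0 : average F 0 = 0 by rewrite /average big1 ?scaler0// => g _; exact: act0.
by rewrite -[c *: x]addr0 averageP a0 addr0.
Qed.

Lemma averageB F x y : average F (x - y) = average F x - average F y.
Proof. by rewrite averageD -scaleN1r averageZ scaleN1r. Qed.

Lemma average_cone F : F != fset0 -> average F cone = cone.
Proof.
move=> F0; rewrite /average (eq_bigr (fun=> cone)); last by move=> g _; exact: act_cone.
rewrite big_const_seq count_predT iter_addr_0 -[cone *+ _]scaler_nat scalerA.
rewrite mulVf ?scale1r//.
by rewrite pnatr_eq0 -lt0n cardfs_gt0.
Qed.

Lemma average_star F x : average F (star x) = star (average F x).
Proof.
rewrite /average starZ fmorphV rmorph_nat; congr (_ *: _).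
rewrite (big_morph star (@starD _ A) (star0 A)).
by apply: eq_bigr => g _; exact: act_star.
Qed.

Lemma positive_functional_act w g : positive_functional w ->
  positive_functional (w \o Theta g).
Proof.
move=> [wl w0]; split=> [c x y|_ [a ->]] /=; first by rewrite actP wl.
case: (Theta_sys.1 g) => _ _ m s.
by apply: w0; exists (Theta g a); rewrite m s.
Qed.

Lemma positive_functional_average w F : positive_functional w ->
  positive_functional (w \o average F).
Proof.
move=> wp; split=> [c x y|a ap] /=; first by rewrite averageP wp.1.
rewrite /average (scalarfZ wp.1) mulr_ge0 ?invr_ge0// (scalarf_sum wp.1).
by apply: sumr_ge0 => g _; exact: (positive_functional_act g wp).2.
Qed.

Lemma invariant_average chi F x : F != fset0 -> invariant_states Theta chi ->
  chi (average F x) = chi x.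
Proof.
move=> F0 [[chil _ _] chiG].
rewrite /average (scalarfZ chil) (scalarf_sum chil) (eq_bigr (fun=> chi x)).
  rewrite big_const_seq count_predT iter_addr_0 -[chi x *+ _]mulr_natl mulrA.
  rewrite mulVf ?mul1r//.
  by rewrite pnatr_eq0 -lt0n cardfs_gt0.
by move=> g _; exact: chiG.
Qed.

End Averages.

(** * Almost invariance of averages over Folner sets *)

Section FolnerAverages.
Variables (R : realType) (A : cstarAlgType R[i]) (G : groupType).
Variable Theta : G -> A -> A.
Hypothesis Theta_sys : cstar_system Theta.
Implicit Types (F : {fset G}) (x y : A) (w : A -> R[i]) (g h : G).

Definition folner_defect F h : R :=
  let Fh := [fset (g * h)%g | g in F]%fset in
  #|` ((Fh `\` F) `|` (F `\` Fh))%fset|%:R / #|` F|%:R.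

(** Averaging [Theta h x] over [F] sums the orbit of [x] over [F h]. The terms over the intersection
    with [F] cancel, and each term left over contributes at most the norm of [x] times [w cone]. *)
Lemma average_actB_le w F h x : positive_functional w -> star x = x ->
  w (average Theta F (Theta h x) - average Theta F x) <=
  (folner_defect F h)%:C%C * (`|x| * w cone).
Proof.
move=> wp xs.
pose Fh := [fset (g * h)%g | g in F]%fset.
have -> : average Theta F (Theta h x) - average Theta F x = (#|` F|%:R : R[i])^-1 *:
    (\sum_(g <- (Fh `\` F)%fset) Theta g x - \sum_(g <- (F `\` Fh)%fset) Theta g x).
  rewrite /average -scalerBr; congr (_ *: _).
  have -> : \sum_(g <- F) Theta g (Theta h x) = \sum_(g <- Fh) Theta g x.
    rewrite big_imfset/=; last by move=> g g' _ _; exact: mulIg.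
    by apply: eq_bigr => g _; rewrite Theta_sys.2.
  rewrite (big_fsetID _ (mem F)) [X in _ - X](big_fsetID _ (mem Fh))/=.
  have -> : [fset x0 in Fh | x0 \in F]%fset = [fset x0 in F | x0 \in Fh]%fset.
    by apply/fsetP => g; rewrite !inE andbC.
  rewrite opprD addrACA subrr add0r; congr (_ - _); apply: eq_fbigl => g.
    by rewrite !inE andbC.
  by rewrite !inE andbC.
rewrite (scalarfZ wp.1) (scalarfB wp.1) !(scalarf_sum wp.1).
rewrite /folner_defect -/Fh rmorphM fmorphV !rmorph_nat mulrAC mulrC.
rewrite ler_wpM2r ?invr_ge0//.
have bnd g : - (`|x| * w cone) <= w (Theta g x) <= `|x| * w cone.
  have := positive_functional_norm_le (positive_functional_act Theta_sys g wp) xs.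
  by rewrite /= (act_cone Theta_sys).
have disj : [disjoint (Fh `\` F)%fset & (F `\` Fh)%fset]%fset.
  apply/fdisjointP => g; rewrite !inE => /andP[gF gFh].
  by rewrite negb_and negbK gFh.
rewrite cardfsU (eqP disj) cardfs0 subn0 natrD mulrDl -sumrN.
rewrite lerD// -sum1_size natr_sum mulr_suml ler_sum// => g _; rewrite mul1r.
  by case/andP: (bnd g).
by rewrite lerNl; case/andP: (bnd g).
Qed.

End FolnerAverages.

(** * The Hahn-Banach theorem through minimal sublinear functions *)

Section HahnBanach.
Variables (R : realType) (V : lmodType R).
Implicit Types (p q f : V -> R) (x y : V).

Definition sublinear p :=
  (forall x y, p (x + y) <= p x + p y) /\
  (forall c x, 0 < c -> p (c *: x) <= c * p x).

Lemma sublinear_scale p c x : sublinear p -> 0 < c -> p (c *: x) = c * p x.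
Proof.
move=> [_ pZ] c0; apply/eqP; rewrite eq_le pZ//=.
rewrite -ler_pdivlMl//; have := pZ c^-1 (c *: x).
by rewrite scalerA mulVf ?gt_eqF// scale1r invr_gt0; apply.
Qed.

Lemma sublinear0 p : sublinear p -> p 0 = 0.
Proof.
by move=> ps; have := sublinear_scale 0 ps (@ltr0Sn R 1); rewrite scaler0; lra.
Qed.

Lemma sublinearN_ge p x : sublinear p -> - p (- x) <= p x.
Proof.
by move=> ps; have := ps.1 x (- x); rewrite subrr (sublinear0 ps); lra.
Qed.

(** Used three times: for the directional modification, for the infimum of a chain, and for
    [upper_mean]. *)
Lemma inf_sublinear (S : V -> set R) :
  (forall x, S x !=set0) -> (forall x, has_lbound (S x)) ->
  (forall x y s t, S x s -> S y t -> exists2 r, S (x + y) r & r <= s + t) ->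
  (forall c x s, 0 < c -> S x s -> exists2 r, S (c *: x) r & r <= c * s) ->
  sublinear (fun x => inf (S x)).
Proof.
move=> S0 Slb SD SZ; split=> [x y|c x c0].
  apply/ler_addgt0Pr => e e0; have e2 : 0 < e / 2 by rewrite divr_gt0.
  have [s Ss sx] := inf_adherent e2 (conj (S0 x) (Slb x)).
  have [t St ty] := inf_adherent e2 (conj (S0 y) (Slb y)).
  have [r Sr rst] := SD _ _ _ _ Ss St.
  have := ge_inf (Slb (x + y)) Sr; move: sx ty rst; lra.
apply/ler_addgt0Pr => e e0.
have ec : 0 < c^-1 * e by rewrite mulr_gt0// invr_gt0.
have [s Ss sx] := inf_adherent ec (conj (S0 x) (Slb x)).
have [r Sr rs] := SZ _ _ _ c0 Ss.
apply: le_trans (ge_inf (Slb _) Sr) _; apply: le_trans rs _.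
rewrite -ler_pdivlMl// mulrDr mulrA mulVf ?gt_eqF// mul1r.
exact: ltW.
Qed.

(** The infimum over [s] makes [q] additive in the direction [b]. *)
Definition directional_set q b x : set R :=
  [set q (x + s *: b) - s * q b | s in [set s | 0 <= s]].

Lemma directional_set_lbound q b x : sublinear q ->
  lbound (directional_set q b x) (- q (- x)).
Proof.
move=> qs _ [s /= s0 <-].
have -> : s * q b = q (s *: b).
  have [->|sn0] := eqVneq s 0; first by rewrite mul0r scale0r sublinear0.
  by rewrite sublinear_scale// lt_def sn0.
have := qs.1 (x + s *: b) (- x); rewrite addrAC subrr add0r; lra.
Qed.

(** The last bound is the value at [s = 1]. It shows that a minimal [q] satisfies
    [q (- b) <= - q b], hence is odd. *)
Lemma directional_sublinear q b : sublinear q ->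
  [/\ sublinear (fun x => inf (directional_set q b x)),
      forall x, inf (directional_set q b x) <= q x
    & inf (directional_set q b (- b)) <= - q b].
Proof.
move=> qs.
have lb x : has_lbound (directional_set q b x).
  by exists (- q (- x)); exact: directional_set_lbound.
split.
- apply: inf_sublinear => //.
  + by move=> x; exists (q (x + 0 *: b) - 0 * q b); exists 0 => /=.
  + move=> x y _ _ [s /= s0 <-] [t /= t0 <-].
    exists (q (x + y + (s + t) *: b) - (s + t) * q b).
      by exists (s + t) => //=; rewrite addr_ge0.
    have := qs.1 (x + s *: b) (y + t *: b).
    by rewrite addrACA -scalerDl; lra.
  + move=> c x _ c0 [s /= s0 <-].
    exists (q (c *: x + (c * s) *: b) - (c * s) * q b).
      by exists (c * s) => //=; rewrite mulr_ge0// ltW.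
    by rewrite -scalerA -scalerDr sublinear_scale// mulrBr mulrA.
- move=> x; apply: ge_inf => //.
  by exists 0; rewrite //= scale0r addr0 mul0r subr0.
- apply: ge_inf => //; exists 1; first by rewrite /= ler01.
  by rewrite scale1r addNr mul1r sublinear0// sub0r.
Qed.

(** Zorn's lemma: the infimum of a nonempty chain is finite, being at least [- p (- x)], and it is
    subadditive because any two members of the chain are comparable. *)
Lemma minimal_sublinear p : sublinear p ->
  exists q, [/\ sublinear q, forall x, q x <= p x &
    forall r, sublinear r -> (forall x, r x <= q x) -> forall x, q x <= r x].
Proof.
move=> ps.
pose P q := sublinear q /\ forall x, q x <= p x.
pose T := {q : V -> R | P q}.
pose t0 : T := exist P p (conj ps (fun x => lexx (p x))).
(* The pointwise order is reversed, since Zorn's lemma yields maximal elements. *)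
pose below (q r : T) : bool := `[< forall x, sval r x <= sval q x >].
have belowP (q r : T) : below q r <-> forall x, sval r x <= sval q x.
  by split=> [/asboolP|]; [|move=> ?; apply/asboolP].
have [||C Ctot|t tmin] := @ZL_preorder T t0 below.
- by move=> q; apply/belowP.
- move=> q r s /belowP qr /belowP rs; apply/belowP => x.
  exact: le_trans (rs x) (qr x).
- have [[c0 Cc0]|C0] := pselect (exists c, C c); last first.
    by exists t0 => s Cs; case: C0; exists s.
  pose S x : set R := [set sval c x | c in C].
  have Slb x : lbound (S x) (- p (- x)).
    move=> _ [[q [qs qp]] _ <-] /=; apply: le_trans (sublinearN_ge x qs).
    by rewrite lerN2.
  have hlb x : has_lbound (S x) by exists (- p (- x)).
  have rs : sublinear (fun x => inf (S x)).
    apply: inf_sublinear => //.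
    + by move=> x; exists (sval c0 x), c0.
    + move=> x y _ _ [q Cq <-] [r Cr <-].
      have [/belowP qr|/belowP rq] := Ctot _ _ Cq Cr.
        exists (sval r (x + y)); first by exists r.
        by have := (svalP r).1.1 x y; have := qr x; lra.
      exists (sval q (x + y)); first by exists q.
      by have := (svalP q).1.1 x y; have := rq y; lra.
    + move=> c x _ c_gt0 [q Cq <-].
      by exists (sval q (c *: x)); [exists q|exact: (svalP q).1.2].
  have rp x : inf (S x) <= p x.
    by apply: le_trans (ge_inf (hlb x) _) ((svalP c0).2 x); exists c0.
  exists (exist P _ (conj rs rp)) => s Cs; apply/belowP => x /=.
  by apply: ge_inf => //; exists s.
- have [ts tp] := svalP t; exists (sval t); split => // r rs rt.
  have rp x : r x <= p x by exact: le_trans (rt x) (tp x).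
  by apply/(belowP (exist P r (conj rs rp)) t)/tmin/belowP.
Qed.

(** Modifying [p] in the direction [a] first makes every [f] below it satisfy [f (- a) <= - p a]. A
    minimal such [f] is odd, hence linear, and so [f a >= p a]. *)
Lemma hahn_banach p a : sublinear p ->
  exists f, [/\ scalar f, forall x, f x <= p x & f a = p a].
Proof.
move=> ps; have [pas pap paa] := directional_sublinear a ps.
have [f [fs fp fmin]] := minimal_sublinear pas.
have fN b : f (- b) = - f b.
  have [gs gf gb] := directional_sublinear b fs.
  have := fmin _ gs gf (- b); have := sublinearN_ge (- b) fs.
  by rewrite opprK => *; apply/le_anti/andP; split; lra.
have fD x y : f (x + y) = f x + f y.
  have := fs.1 x y; have := fs.1 (x + y) (- y).
  by rewrite addrK fN => *; apply/le_anti/andP; split; lra.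
have fZ c x : f (c *: x) = c * f x.
  have [c0|c0|->] := ltrgtP c 0.
  - by rewrite -[c]opprK scaleNr fN sublinear_scale ?oppr_gt0// -mulNr.
  - exact: sublinear_scale.
  - by rewrite scale0r mul0r sublinear0.
exists f; split.
- by move=> c x y; rewrite fD fZ.
- by move=> x; apply: le_trans (fp x) (pap x).
- have := fp (- a); rewrite fN => fa; apply/le_anti/andP; split.
    by apply: le_trans (fp a) (pap a).
  by have := le_trans fa paa; rewrite lerN2.
Qed.

End HahnBanach.

(** * Restriction to real scalars, and complexification of functionals *)

Definition restrict_scalars (R : realType) (V : lmodType R[i]) : Type := V.

Section RestrictScalars.
Variables (R : realType) (V : lmodType R[i]).

HB.instance Definition _ := GRing.Zmodule.copy (restrict_scalars V) V.

Definition real_scale (c : R) (x : restrict_scalars V) : restrict_scalars V :=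
  c%:C%C *: (x : V).

Fact real_scaleA c d x : real_scale c (real_scale d x) = real_scale (c * d) x.
Proof. by rewrite /real_scale scalerA rmorphM. Qed.

Fact real_scale1 : left_id 1 real_scale.
Proof. by move=> x; exact: scale1r. Qed.

Fact real_scaleDr : right_distributive real_scale +%R.
Proof. by move=> c x y; exact: scalerDr. Qed.

Fact real_scaleDl x : {morph real_scale^~ x : c d / c + d}.
Proof. by move=> c d; rewrite /real_scale rmorphD; exact: scalerDl. Qed.

HB.instance Definition _ := GRing.Zmodule_isLmodule.Build R (restrict_scalars V)
  real_scaleA real_scale1 real_scaleDr real_scaleDl.

(** A real functional is the real part of a unique complex one. *)
Definition complexified (f : restrict_scalars V -> R) (x : V) : R[i] :=
  (f x)%:C%C - 'i%C * (f ('i%C *: x))%:C%C.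

Lemma complexified_scalar (f : restrict_scalars V -> R) :
  scalar f -> scalar (complexified f).
Proof.
move=> fl.
have fD (x y : V) : f (x + y) = f x + f y.
  by have := fl 1 x y; rewrite mul1r scale1r.
have f0 : f 0 = 0 by have := fD 0 0; rewrite addr0; lra.
have fZ r (x : V) : f (r%:C%C *: x) = r * f x.
  by have := fl r x 0; rewrite addr0 f0 addr0.
have fN (x : V) : f (- x) = - f x.
  by rewrite -scaleN1r -[-1](rmorphN1 (real_complex R)) fZ mulN1r.
move=> [u v] x y; rewrite /complexified.
have uvE : (u +i* v)%C = u%:C%C + v%:C%C * 'i%C by simpc.
have E : (u +i* v)%C *: x + y = u%:C%C *: x + (v%:C%C *: ('i%C *: x) + y).
  by rewrite uvE scalerDl -scalerA addrA.
have iE : 'i%C *: ((u +i* v)%C *: x + y) =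
    u%:C%C *: ('i%C *: x) + (v%:C%C *: (- x) + 'i%C *: y).
  rewrite uvE scalerDr scalerDl scalerDr addrA !scalerA; congr (_ *: _ + _ + _).
    by rewrite mulrC.
  by rewrite mulrCA -expr2 sqr_i mulrN1 scaleNr scalerN.
rewrite iE E !fD !fZ fN.
move: (f x) (f ('i%C *: x)) (f y) (f ('i%C *: y)) => p q s t.
by simpc; congr (_ +i* _)%C; ring.
Qed.

End RestrictScalars.

(** * Invariant states from the upper mean, and the gauge *)

Section InvariantStates.
Variables (R : realType) (A : cstarAlgType R[i]) (G : groupType).
Variable Theta : G -> A -> A.
Hypothesis Theta_sys : cstar_system Theta.
Variable F : nat -> {fset G}.
Hypothesis F_folner : right_folner R F.
Implicit Types (x y a : A) (phi chi w : A -> R[i]).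

Lemma invariant_state_le_average chi a k : positive_elt a ->
  invariant_states Theta chi -> chi a <= `|average Theta (F k) a|.
Proof.
move=> ap chiI; rewrite -(invariant_average a (F_folner.1 k) chiI).
have [chis chi1 chip] := chiI.1.
rewrite -[leRHS]mulr1 -chi1 positive_functional_le//.
by rewrite -(average_star Theta_sys) positive_elt_sa.
Qed.

(** [x + star x] is twice the self-adjoint part of [x], hence the factors [2] below. *)
Definition eventual_bounds x : set R :=
  [set t | \forall k \near \oo, forall w, positive_functional w ->
     w (average Theta (F k) (x + star x)) <= t%:C%C * w cone].

Lemma addr_star_sa x : star (x + star x) = x + star x.
Proof. by rewrite starD starK addrC. Qed.

Lemma eventual_bounds_norm x : eventual_bounds x (complex.Re `|x + star x|).
Proof.
apply: nearW => k w wp; rewrite ge0_ReE//.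
have := positive_functional_le (positive_functional_average Theta_sys (F k) wp)
  (addr_star_sa x).
by rewrite /= (average_cone Theta_sys (F_folner.1 k)).
Qed.

Lemma eventual_boundsD x y s t : eventual_bounds x s -> eventual_bounds y t ->
  eventual_bounds (x + y) (s + t).
Proof.
move=> xs yt; near=> k => w wp.
have -> : x + y + star (x + y) = (x + star x) + (y + star y).
  by rewrite starD addrACA.
rewrite (averageD Theta_sys) (scalarfD wp.1) rmorphD mulrDl lerD//.
  by move: w wp; near: k.
by move: w wp; near: k.
Unshelve. all: by end_near. Qed.

Lemma eventual_boundsZ (c : R) x s : 0 < c -> eventual_bounds x s ->
  eventual_bounds (c%:C%C *: x) (c * s).
Proof.
move=> c0; apply: filterS => k ks w wp.
have -> : c%:C%C *: x + star (c%:C%C *: x) = c%:C%C *: (x + star x).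
  have -> : star (c%:C%C *: x) = c%:C%C *: star x.
    by rewrite starZ geC0_conj// lecR ltW.
  by rewrite scalerDr.
rewrite (averageZ Theta_sys) (scalarfZ wp.1) rmorphM -mulrA.
by rewrite ler_wpM2l ?lecR ?(ltW c0)// ks.
Qed.

(** Makes the dominated functional vanish on skew-adjoint elements. *)
Lemma eventual_bounds_star_eq0 x : x + star x = 0 -> eventual_bounds x 0.
Proof.
by move=> x0; have := eventual_bounds_norm x; rewrite x0 normr0.
Qed.

Lemma eventual_bounds_opp_positive a : positive_elt a -> eventual_bounds (- a) 0.
Proof.
move=> ap; apply: nearW => k w wp.
have := (positive_functional_average Theta_sys (F k) wp).2 _ ap => /= aw.
have -> : - a + star (- a) = (- 2) *: a.
  by rewrite starN positive_elt_sa// scaleNr scaler_nat mulr2n opprD.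
rewrite (averageZ Theta_sys) (scalarfZ wp.1) rmorph0 mul0r mulNr oppr_le0.
by rewrite mulr_ge0.
Qed.

(** The Folner defect times the norm of [x + star x] is eventually below [e]; this is the source of
    invariance. *)
Lemma eventual_bounds_act x h (e : R) : 0 < e ->
  eventual_bounds (Theta h x - x) e.
Proof.
move=> e0; pose m := complex.Re `|x + star x|.
have m0 : 0 <= m by have := normr_ge0 (x + star x); rewrite normcE (lecR 0).
(* The added 1 covers the case [m = 0]. *)
have em : 0 < e / (m + 1) by rewrite divr_gt0// ltr_wpDl.
have /cvgrPdist_lt /(_ _ em) := F_folner.2 h.
apply: filterS => k; rewrite sub0r normrN ger0_norm; last first.
  by rewrite divr_ge0.
rewrite -/(folner_defect R (F k) h) => /ltW de w wp.
have E : Theta h x - x + star (Theta h x - x) =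
   Theta h (x + star x) - (x + star x).
  rewrite (actD Theta_sys) (act_star Theta_sys) starD starN opprD.
  by rewrite addrACA.
have w1 : 0 <= w cone by apply: wp.2; exact: positive_elt_cone.
rewrite E (averageB Theta_sys).
apply: le_trans (average_actB_le Theta_sys (F k) h wp (addr_star_sa x)) _.
rewrite mulrA ler_wpM2r// normcE -rmorphM lecR -/m.
have d0 : 0 <= folner_defect R (F k) h by rewrite divr_ge0.
move: de; rewrite ler_pdivlMr ?ltr_wpDl//; apply: le_trans.
by rewrite ler_wpM2l// lerDl.
Qed.

(** Negative [c] matters: [c = 1] and [c = -1] together fix the value of the functional at the
    unit. *)
Lemma eventual_bounds_cone (c : R) : eventual_bounds (c%:C%C *: cone) (c + c).
Proof.
apply: nearW => k w wp.
have -> : c%:C%C *: (cone : A) + star (c%:C%C *: cone) = (c + c)%:C%C *: cone.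
  have -> : star (c%:C%C *: cone) = c%:C%C *: (cone : A).
    by rewrite starZ star1; congr (_ *: _); exact: conjc_real.
  by rewrite rmorphD scalerDl.
by rewrite (averageZ Theta_sys) (average_cone Theta_sys (F_folner.1 k))
  (scalarfZ wp.1).
Qed.

(** Bounds the set below, so that its infimum is meaningful: at an index where [t] is a bound,
    evaluate it on [w], for which [w cone = 1]. *)
Lemma state_eventual_bounds w x t : state w -> eventual_bounds x t ->
  - complex.Re `|x + star x| <= t.
Proof.
move=> ws [k _ /(_ k (leqnn k)) kt].
have wp := state_positive_functional ws.
have := positive_functional_norm_le (positive_functional_average Theta_sys (F k) wp)
  (addr_star_sa x).
rewrite /= (average_cone Theta_sys (F_folner.1 k)) => /andP[+ _].
move=> /le_trans/(_ (kt w wp)).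
by case: ws => _ -> _; rewrite !mulr1 normcE -rmorphN lecR.
Qed.

Definition upper_mean x := inf (eventual_bounds x).

Lemma upper_mean_sublinear w : state w ->
  sublinear (upper_mean : restrict_scalars A -> R).
Proof.
move=> ws; apply: inf_sublinear.
- by move=> x; eexists; exact: eventual_bounds_norm.
- by move=> x; eexists => t; exact: state_eventual_bounds ws.
- by move=> x y s t xs yt; exists (s + t) => //; exact: eventual_boundsD.
- by move=> c x s c0 xs; exists (c * s) => //; exact: eventual_boundsZ.
Qed.

Lemma upper_mean_le w x t : state w -> eventual_bounds x t -> upper_mean x <= t.
Proof.
move=> ws xt; apply: ge_inf => //.
by eexists => s; exact: state_eventual_bounds ws.
Qed.

(** Each eventual bound of [x] bounds the Hahn-Banach functional [f] at [x]. Skew-adjoint elements,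
    the unit, negatives of positive elements and the differences [Theta h x - x] thus yield reality
    on self-adjoint elements, the value 2 at the unit, positivity and invariance. *)
Lemma invariant_state_upper_mean w a : state w -> positive_elt a ->
  exists2 psi, invariant_states Theta psi & psi a = (upper_mean a / 2)%:C%C.
Proof.
move=> ws ap.
have [f [fl fle fa]] := hahn_banach (a : restrict_scalars A) (upper_mean_sublinear ws).
have fle' (x : A) t : eventual_bounds x t -> f x <= t.
  by move=> xt; apply: le_trans (fle x) (upper_mean_le ws xt).
have fN (x : A) : f (- x) = - f x.
  have f0 : f 0 = 0 by have := fl 1 0 0; rewrite scaler0 addr0; lra.
  by have := fl (-1) x 0; rewrite scaleN1r addr0 f0 => ->; rewrite addr0 mulN1r.
have fB (x y : A) : f (x - y) = f x - f y.
  by have := fl 1 x (- y); rewrite scale1r mul1r fN.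
have f0 (x : A) : x + star x = 0 -> f x = 0.
  move=> x0; have x0' : - x + star (- x) = 0 by rewrite starN -opprD x0 oppr0.
  have := fle' _ _ (eventual_bounds_star_eq0 x0).
  have := fle' _ _ (eventual_bounds_star_eq0 x0').
  by rewrite fN => *; apply/le_anti/andP; split; lra.
have fi (x : A) : star x = x -> f ('i%C *: x) = 0.
  move=> xs; apply: f0; rewrite starZ xs -scalerDl.
  have -> : Num.conj ('i%C : R[i]) = - 'i%C by exact: conjCi.
  by rewrite subrr scale0r.
have f1 : f (cone : A) = 2.
  have := fle' _ _ (eventual_bounds_cone 1).
  have := fle' _ _ (eventual_bounds_cone (-1)).
  rewrite rmorphN1 scaleN1r fN rmorph1 scale1r => *.
  by apply/le_anti/andP; split; lra.
have fpos (b : A) : positive_elt b -> 0 <= f b.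
  move=> bp; rewrite -oppr_le0 -fN; apply: fle'.
  exact: eventual_bounds_opp_positive.
(* The bound at [x] gives one inequality, the bound at [- x] the other. *)
have finv h (x : A) : f (Theta h x) = f x.
  have le h' (y : A) : f (Theta h' y - y) <= 0.
    by apply/ler_addgt0Pr => e e0; rewrite add0r fle'//; exact: eventual_bounds_act.
  have := le h x; have := le h (- x).
  rewrite (actN Theta_sys).
  by rewrite !fB !fN => *; apply/le_anti/andP; split; lra.
have cl := complexified_scalar fl.
exists (fun x => complexified f x / 2); last first.
  rewrite /complexified fi ?positive_elt_sa// fa rmorph0 mulr0 subr0.
  by rewrite rmorphM fmorphV rmorph_nat.
have real (x : A) : star x = x -> complexified f x / 2 = (f x / 2)%:C%C.
  move=> xs; rewrite /complexified fi// rmorph0 mulr0 subr0.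
  by rewrite rmorphM fmorphV rmorph_nat.
split; last first.
  move=> g x; rewrite /complexified finv.
  by rewrite -(actZ Theta_sys) finv.
split.
- by move=> c x y; rewrite cl mulrDl mulrA.
- by rewrite real ?star1// f1 divff ?pnatr_eq0// rmorph1.
- move=> b bp; rewrite real; last exact: positive_elt_sa.
  by rewrite (lecR 0) divr_ge0// fpos.
Qed.

(** A squeeze: the norms of the averages are at least [psi a], which is half the upper mean, and for
    every eventual bound [t] they are eventually at most [t / 2] by [norm_le_of_functionals]. *)
Lemma gauge_attained phi a : faithful_state phi -> positive_elt a ->
  exists2 psi, invariant_states Theta psi &
    psi a = (gauge Theta F a)%:C%C /\
    forall chi, invariant_states Theta chi -> chi a <= (gauge Theta F a)%:C%C.
Proof.
move=> phif ap.
have [psi psiI psia] := invariant_state_upper_mean phif.1 ap.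
have cv : (fun k => complex.Re `|average Theta (F k) a|) @ \oo --> upper_mean a / 2.
  have phip := state_positive_functional phif.1.
  apply/cvgrPdist_lt => e e0.
  have e2 : 0 < 2 * e by rewrite mulr_gt0.
  have hi : has_inf (eventual_bounds a).
    split; first by eexists; exact: eventual_bounds_norm.
    by eexists => t; exact: state_eventual_bounds phif.1.
  have [t Tt ta] := inf_adherent e2 hi.
  move: Tt; apply: filterS => k tk.
  have aa : average Theta (F k) (a + star a) = 2 *: average Theta (F k) a.
    by rewrite positive_elt_sa// (averageD Theta_sys) scaler_nat mulr2n.
  have avp w : positive_functional w -> 0 <= w (average Theta (F k) a).
    by move=> wp; exact: (positive_functional_average Theta_sys (F k) wp).2.
  have tk' w : positive_functional w ->
      w (average Theta (F k) a) <= (t / 2)%:C%C * w cone.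
    move=> wp; have := tk w wp; rewrite aa (scalarfZ wp.1) => wt.
    by rewrite rmorphM fmorphV rmorph_nat mulrAC ler_pdivlMr// mulrC.
  have t0 : 0 <= (t / 2)%:C%C :> R[i].
    have := le_trans (avp _ phip) (tk' _ phip).
    by case: phif.1 => _ -> _; rewrite mulr1.
  have nt : `|average Theta (F k) a| <= (t / 2)%:C%C.
    apply: (norm_le_of_functionals phif) => //.
      by rewrite -(average_star Theta_sys) positive_elt_sa.
    by move=> w wp; rewrite avp// tk'.
  have := invariant_state_le_average k ap psiI.
  rewrite psia; move: nt; rewrite (normcE (average Theta (F k) a)) !lecR => nt ge.
  rewrite distrC ger0_norm ?subr_ge0//.
  move: ta; rewrite -/(upper_mean a); lra.
(* [gauge] is a [lim], which has this value because [cv] establishes convergence. *)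
have gE : gauge Theta F a = upper_mean a / 2 by exact: cvg_lim cv.
exists psi => //; split; first by rewrite gE.
move=> chi chiI; rewrite gE.
have c0 : 0 <= chi a by case: (chiI) => -[_ _ chip] _; exact: chip.
rewrite -(ge0_ReE c0) lecR.
apply: (cvgr_to_ge cv); apply: nearW => k; rewrite -lecR -normcE ge0_ReE//.
exact: invariant_state_le_average.
Qed.

End InvariantStates.

(** The difference [d] is a positive functional vanishing at the unit, so its norm bound is 0 on
    self-adjoint elements; these span the algebra. *)
Lemma state_eq_of_le (R : realType) (A : cstarAlgType R[i]) (phi chi : A -> R[i]) :
  state phi -> state chi -> (forall a, positive_elt a -> chi a <= phi a) ->
  chi = phi.
Proof.
move=> [phil phi1 _] [chil chi1 _] le.
pose d a := phi a - chi a.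
have dl : scalar d by move=> c x y; rewrite /d phil chil mulrBr opprD addrACA.
have dp : positive_functional d by split=> // a ap; rewrite subr_ge0 le.
have d0 y : star y = y -> d y = 0.
  move=> /(positive_functional_norm_le dp).
  by rewrite /d phi1 chi1 subrr mulr0 oppr0 => /le_anti.
apply/funext => x; apply/esym/eqP; rewrite -subr_eq0 -/(d x).
have dD : d (x + star x) = 0 by rewrite d0// starD starK addrC.
have dB : d ('i *: (x - star x)) = 0.
  by rewrite d0// starZ conjCi starD starN starK scaleNr -scalerN opprB.
move: dD dB; rewrite (scalarfZ dl) => dD /eqP; rewrite mulf_eq0 (negbTE (neq0Ci _)) /=.
rewrite (scalarfB dl) subr_eq0 => /eqP dE; move: dD; rewrite (scalarfD dl) -dE.
by move/eqP; rewrite -mulr2n -mulr_natl mulf_eq0 pnatr_eq0.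
Qed.

(** * The state induced on the model by the trace *)

Lemma wot_inner_continuous (K : numClosedFieldType) (H : hilbertType K) (x y : H) :
  continuous (fun T : wot H => inner (T x) y : K^o).
Proof.
move=> T.
pose ev (S : wot H) : {ptws (H * H)%type -> K^o} := fun p => inner (S p.1) p.2.
have cev : continuous ev by exact: initial_continuous.
refine (proj1 (@pointwise_cvgP (H * H)%type K^o (ev @ T) (ev T) _) (cev T) (x, y)).
exact: (@fmap_filter _ _ _ _ (nbhs_filter T)).
Qed.

Section InnerProduct.
Variables (K : numClosedFieldType) (H : hilbertType K).
Implicit Types (x y : H).

Lemma inner_ge0 x : 0 <= inner x x.
Proof. by rewrite inner_norm exprn_ge0. Qed.

Lemma inner_eq0 x : (forall y, inner y x = 0) -> x = 0.
Proof.
by move=> /(_ x)/eqP; rewrite inner_norm sqrf_eq0 normr_eq0 => /eqP.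
Qed.

End InnerProduct.

Section ModelState.
Variables (K : numClosedFieldType) (H : hilbertType K) (M : set (H -> H)).
Variables (rho : (H -> H) -> K) (A : cstarAlgType K) (iota : A -> (H -> H)).
Hypothesis M_vn : von_neumann_algebra M.
Hypothesis iota_hom : star_homomorphism M iota.
Hypothesis iota_dense : M `<=` wot_closure (range iota).

(** Unitality comes from density: [iota cone] is self-adjoint and fixes the ranges of all [iota a],
    so [z] is orthogonal to each [iota a x], and weak approximation of the identity makes [z]
    orthogonal to every [x]. *)
Lemma model_cone : iota cone = idfun.
Proof.
have eadj : is_adjoint (iota cone) (iota cone).
  by have := sh_star iota_hom cone; rewrite star1.
apply/funext => y /=; apply/eqP; rewrite -subr_eq0; apply/eqP.
apply: inner_eq0 => x; set z := iota cone y - y.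
have [idcl _] := iota_dense (vn_id M_vn).
apply/eqP; rewrite -normr_le0; apply/ler_addgt0Pl => e e0; rewrite addr0.
have cont := @wot_inner_continuous K H x z idfun.
have [_ [[a _ <-]]] := idcl _ (cont _ (nbhsx_ballx _ _ e0)).
rewrite /= -ball_normE /=.
suff -> : inner (iota a x) z = 0 by rewrite subr0 => /ltW.
have ea : iota cone (iota a x) = iota a x.
  by rewrite -[LHS]/((iota cone \o iota a) x) -(sh_mul iota_hom) cmul1l.
rewrite /z linearBr; apply/eqP; rewrite subr_eq0; apply/eqP.
by apply: etrans (esym (eadj _ _)) _; rewrite ea.
Qed.

Lemma model_op_positive a : positive_elt a -> op_positive (iota a).
Proof.
move=> [b ->] x; rewrite (sh_mul iota_hom) /= (sh_star iota_hom) starK.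
exact: inner_ge0.
Qed.

Hypothesis rho_fnt : faithful_normal_tracial_state M rho.

Lemma model_state : state (rho \o iota).
Proof.
have inM := sh_in iota_hom.
split.
- by move=> c a b /=; rewrite (sh_lin iota_hom) (fnt_lin rho_fnt).
- by rewrite /= model_cone (fnt_id rho_fnt).
- by move=> a ap; apply: (fnt_pos rho_fnt) => //; exact: model_op_positive.
Qed.

Lemma model_faithful_state : injective iota -> faithful_state (rho \o iota).
Proof.
move=> inj; split; first exact: model_state.
move=> a ap a0; apply: inj.
have -> : iota a = 0.
  apply: (fnt_faithful rho_fnt) => //; first exact: (sh_in iota_hom).
  exact: model_op_positive.
have := sh_lin iota_hom (-1) 0 0.
by rewrite scaler0 addr0 scaleN1r addNr.
Qed.

End ModelState.

Theorem theorem3p9 (R : realType) (G : groupType)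
    (H : hilbertType R[i]) (M : set (H -> H)) (rho : (H -> H) -> R[i])
    (Xi : G -> (H -> H) -> (H -> H))
    (L : hilbertType R[i]) (Lambda : (H -> H) -> L)
    (A : cstarAlgType R[i]) (Theta : G -> A -> A) (iota : A -> (H -> H)) :
  countable [set: G] -> amenable R G ->
  wstar_system M rho Xi ->
  is_L2 M rho Lambda -> separable L ->
  faithful_cstar_model M Xi Theta iota -> separable A ->
  [/\ uniquely_ergodic Theta <-> strictly_ergodic Theta,
      forall F : nat -> {fset G}, right_folner R F ->
        uniquely_ergodic Theta ->
        forall a, positive_elt a -> (gauge Theta F a)%:C%C = rho (iota a)
    & simplex (invariant_states_dual Theta) ->
      forall F : nat -> {fset G}, right_folner R F ->
        (forall a, positive_elt a -> (gauge Theta F a)%:C%C = rho (iota a)) ->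
        uniquely_ergodic Theta].
Proof.
move=> _ _ [Mvn rhof _ _ rhoinv] _ _ [[sys hom dns _ equiv] inj] _.
pose phi := rho \o iota.
have phif : faithful_state phi by exact: (model_faithful_state Mvn).
have phiI : invariant_states Theta phi.
  split; first exact: phif.1.
  by move=> g a; rewrite /phi /= -equiv rhoinv//; exact: (sh_in hom).
have uniq chi0 : invariant_states Theta = [set chi0] -> chi0 = phi.
  by move=> E; move: phiI; rewrite E => /= ->.
split.
- split=> [[chi0 E]|[chi0 E _]]; last by exists chi0.
  by exists chi0 => //; rewrite (uniq _ E).
- move=> F Ffol [chi0 E] a ap.
  have [psi psiI [<- _]] := gauge_attained sys Ffol phif ap.
  by move: psiI; rewrite E => /= ->; rewrite (uniq _ E).
- move=> _ F Ffol gaugeE; exists phi; apply/seteqP; split=> [chi chiI|_ ->//].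
  apply: state_eq_of_le chiI.1 _; first exact: phif.1.
  move=> a ap; rewrite /phi /= -gaugeE//.
  (* The gauge, here equal to [phi], dominates every invariant state on positive elements. *)
  have [_ _ [_]] := gauge_attained sys Ffol phif ap.
  exact.
Qed.
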